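(* Let $p\in[1,\infty)$, $a\in[0,1)$, and let $\phi:\mathbb{R}^d\to\mathbb{R}^d$ be a bi-Lipschitz homeomorphism preserving Lebesgue measure. Then there is a constant $C$ depending only on $d$, $p$ and $a$ such that for every locally integrable $f$ on $\mathbb{R}^d$, $$\|f\circ\phi\|^\sharp_{p,a}\le C\,\rho_a(K_\phi)\,\|f\|^\sharp_{p,a}.$$ In particular (case $a=0$), $\|f\circ\phi\|_{\mathrm{BMO}}\le C\log(K_\phi)\|f\|_{\mathrm{BMO}}$, and for $a\in(0,1)$, $\|f\circ\phi\|_{\mathrm{Lip}_p(a)}\le C K_\phi^a\|f\|_{\mathrm{Lip}_p(a)}$.
   Context: For a bi-Lipschitz homeomorphism $\phi$ of $\mathbb{R}^d$, $K_\phi:=\sup_{x\neq y}\left(\frac{|\phi(x)-\phi(y)|}{|x-y|}+\frac{|x-y|}{|\phi(x)-\phi(y)|}\right)$. ''Preserving Lebesgue measure'' means $|\phi(A)|=|A|$ for all measurable $A$. For $a\in[0,1]$, $\rho_a(r)=r^a$ if $a>0$ and $\rho_0(r)=\log r$. For $p\in[1,\infty)$, $a\in[0,1]$ and $f\in L^1_{loc}(\mathbb{R}^d)$, $$\|f\|^\sharp_{p,a}=\sup_B\left(\frac{1}{|B|^{1+ap/d}}\int_B\Big|f(y)-\frac{1}{|B|}\int_B f\Big|^p\,dy\right)^{1/p},$$ the supremum over all balls $B\subset\mathbb{R}^d$. $\mathrm{BMO}$ is the space of $f$ with $\|f\|^\sharp_{1,0}<\infty$ (by John–Nirenberg, $\|f\|^\sharp_{p,0}$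 are all equivalent norms, denoted $\|f\|_{\mathrm{BMO}}$), and $\mathrm{Lip}_p(a)$, $a\in(0,1]$, is the space of $f$ with $\|f\|^\sharp_{p,a}<\infty$, normed by $\|f\|^\sharp_{p,a}$. *)

(* Defs.v *)
From HB Require Import structures.
From mathcomp Require Import all_boot all_order all_algebra.
From mathcomp Require Import all_classical all_reals all_analysis.

Set Implicit Arguments.
Unset Strict Implicit.
Unset Printing Implicit Defensive.
Import Order.TTheory GRing.Theory Num.Theory.
Import numFieldNormedType.Exports.

Local Open Scope classical_set_scope.
Local Open Scope ring_scope.

Definition enorm {R : realType} {d : nat} (x : 'rV[R]_d) : R :=
  Num.sqrt (\sum_(i < d) x ord0 i ^+ 2).

Definition eball {R : realType} {d : nat} (c : 'rV[R]_d) (r : R) :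
  set 'rV[R]_d := [set x | enorm (x - c) < r].

(* Lebesgue measure on R^d: Caratheodory restriction of the Lebesgue   *)
(* outer measure  |A|^* = inf { sum_k vol(Q_k) : A ⊆ U_k Q_k,          *)
(* Q_k closed boxes }.                                                 *)

Definition box {R : realType} {d : nat} (a b : 'rV[R]_d) : set 'rV[R]_d :=
  [set x | forall i, a ord0 i <= x ord0 i <= b ord0 i].

Definition box_vol {R : realType} {d : nat} (a b : 'rV[R]_d) : R :=
  \prod_(i < d) (b ord0 i - a ord0 i).

(* R^d with the discrete sigma-algebra: only used so that covers by    *)
(* arbitrary sets are allowed in the library's [mu_ext].               *)
Definition Rdisc (R : realType) (d : nat) := 'rV[R]_d.
HB.instance Definition _ (R : realType) (d : nat) :=
  Pointed.on (Rdisc R d).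
HB.instance Definition _ (R : realType) (d : nat) :=
  @isMeasurable.Build default_measure_display (Rdisc R d)
    discrete_measurable discrete_measurable0
    discrete_measurableC discrete_measurableU.

(* volume of a set that is a box (or empty); +oo for other sets *)
Definition box_content (R : realType) (d : nat) (A : set (Rdisc R d)) : \bar R :=
  ereal_inf [set x : \bar R | (A = set0 /\ x = 0%E) \/
    exists a b : 'rV[R]_d, (forall i, a ord0 i <= b ord0 i) /\
      A = box a b /\ x = (box_vol a b)%:E].

Lemma box_content_ge0 (R : realType) (d : nat) (A : set (Rdisc R d)) :
  (0 <= box_content A)%E.
Proof.
apply: le_ereal_inf_tmp => x [[_ ->]//|[a [b [ab [_ ->]]]]].
rewrite lee_fin /box_vol; apply: prodr_ge0 => i _.
by rewrite subr_ge0.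
Qed.

Lemma box_content0 (R : realType) (d : nat) :
  box_content (set0 : set (Rdisc R d)) = 0%E.
Proof.
apply/eqP; rewrite eq_le box_content_ge0 andbT.
by apply: ereal_inf_lbound; left.
Qed.

Definition lebesgue_outer (R : realType) (d : nat) : set (Rdisc R d) -> \bar R :=
  mu_ext (@box_content R d).

HB.instance Definition _ (R : realType) (d : nat) :=
  isOuterMeasure.Build R (Rdisc R d) (@lebesgue_outer R d)
    (mu_ext0 (@box_content0 R d) (@box_content_ge0 R d))
    (mu_ext_ge0 (@box_content_ge0 R d))
    (le_mu_ext (@box_content R d))
    (mu_ext_sigma_subadditive (@box_content_ge0 R d)).

Definition Rd (R : realType) (d : nat) := caratheodory_type (@lebesgue_outer R d).

Definition lebesgue_d (R : realType) (d : nat) : set (Rd R d) -> \bar R :=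
  @lebesgue_outer R d.
HB.instance Definition _ (R : realType) (d : nat) :=
  isMeasure.Build _ (Rd R d) R (@lebesgue_d R d)
    (@caratheodory_measure0 R _ (@lebesgue_outer R d))
    (@caratheodory_measure_ge0 R _ (@lebesgue_outer R d))
    (@caratheodory_measure_sigma_additive R _ (@lebesgue_outer R d)).


Definition bi_lipschitz {R : realType} {d : nat} (phi : 'rV[R]_d -> 'rV[R]_d) :=
  exists L : R, forall x y,
    enorm (phi x - phi y) <= L * enorm (x - y) /\
    enorm (x - y) <= L * enorm (phi x - phi y).

Definition preserves_lebesgue {R : realType} {d : nat}
    (phi : 'rV[R]_d -> 'rV[R]_d) :=
  forall A : set (Rd R d), measurable A ->
    lebesgue_d (phi @` A) = lebesgue_d A.

(* K_phi as an extended real (finite when phi is bi-Lipschitz) *)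
Definition Kphi {R : realType} {d : nat} (phi : 'rV[R]_d -> 'rV[R]_d) : \bar R :=
  ereal_sup [set z : \bar R | exists x y : 'rV[R]_d, x != y /\
    z = (enorm (phi x - phi y) / enorm (x - y)
         + enorm (x - y) / enorm (phi x - phi y))%:E].

Definition rho {R : realType} (a r : R) : R :=
  if a == 0 then ln r else r `^ a.

Definition L1loc {R : realType} {d : nat} (f : 'rV[R]_d -> R) :=
  forall (c : 'rV[R]_d) (r : R), 0 < r ->
    (@lebesgue_d R d).-integrable (eball c r : set (Rd R d)) (EFin \o f).

Definition avg {R : realType} {d : nat} (f : 'rV[R]_d -> R)
    (B : set 'rV[R]_d) : R :=
  (fine (@lebesgue_d R d B))^-1 *
    Rintegral (@lebesgue_d R d) (B : set (Rd R d)) f.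

Definition osc {R : realType} {d : nat} (p a : R) (f : 'rV[R]_d -> R)
    (B : set 'rV[R]_d) : \bar R :=
  (((fine (@lebesgue_d R d B)) `^ (1 + a * p / d%:R))^-1)%:E *
  (\int[@lebesgue_d R d]_(y in (B : set (Rd R d))) (`|f y - avg f B| `^ p)%:E)%E.

Definition sharp_norm {R : realType} {d : nat} (p a : R) (f : 'rV[R]_d -> R) :
  \bar R :=
  ((ereal_sup [set osc p a f B | B in
      [set B : set 'rV[R]_d | exists (c : 'rV[R]_d) (r : R), (0 < r)%R /\ B = eball c r]])
   `^ p^-1)%E.

(* Main.v *)
(* Put B = B(c,r), K = K_phi, and let k be the average of f over
   B(phi c, 2Kr). For w in B, the ball B_w centred at phi w with radius
   s(w) = (r - |w-c|)/(4K) is a Whitney ball of the open set phi(B): s is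
   comparable to s(w) at every point of B whose image lies in B_w. Tonelli
   therefore gives
     int_B |f o phi - k|^p <= 4^d int_B (|B_w|^-1 int_{B_w} |f - k|^p) dw.
   Doubling the radius of B_w until it reaches Kr bounds the inner average by
   ||f||^p times (r^a rho_a(K) u^{-1/(2p)})^p up to a constant, where
   u = 1 - |w-c|/r; the number of doublings is O(log(K^2/u)), whence the
   logarithm when a = 0. Finally u^{-1/2} has integral O(|B|) over B because
   the shell {u <= t} has measure O(t |B|). No John-Nirenberg inequality is
   needed. *)
Require Import Defs.
From HB Require Import structures.
From mathcomp Require Import all_boot all_order all_algebra.
From mathcomp Require Import all_classical all_reals all_analysis.
From mathcomp Require Import measurable_realfun ring lra.
Import Order.TTheory GRing.Theory Num.Theory.
Local Open Scope classical_set_scope.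
Local Open Scope ring_scope.

Set Implicit Arguments.
Unset Strict Implicit.

(** * The Euclidean norm *)

Lemma sum_mul_sqr_le (R : realType) (d : nat) (x y : 'I_d -> R) :
  (\sum_i x i * y i) ^+ 2 <= (\sum_i x i ^+ 2) * (\sum_i y i ^+ 2).
Proof.
rewrite -subr_ge0.
(* Lagrange's identity: the defect in Cauchy-Schwarz is half the sum of the squared 2 by 2
   minors. *)
have -> : (\sum_i x i ^+ 2) * (\sum_i y i ^+ 2) - (\sum_i x i * y i) ^+ 2 =
    2^-1 * \sum_i \sum_j (x i * y j - x j * y i) ^+ 2.
  have E (u v : 'I_d -> R) :
      (\sum_i u i) * (\sum_i v i) = \sum_i \sum_j u i * v j.
    by rewrite mulr_suml; apply: eq_bigr => i _; rewrite mulr_sumr.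
  have E2 : \sum_i \sum_j (x i * y j - x j * y i) ^+ 2 =
     \sum_i \sum_j (x i ^+ 2 * y j ^+ 2) +
     \sum_i \sum_j (y i ^+ 2 * x j ^+ 2) -
     2 * \sum_i \sum_j (x i * y i) * (x j * y j).
    rewrite mulr_sumr -big_split -sumrB /=; apply: eq_bigr => i _.
    rewrite mulr_sumr -big_split -sumrB /=; apply: eq_bigr => j _; ring.
  by rewrite E2 -!E; field.
by rewrite mulr_ge0// ?invr_ge0//; do 2!(apply: sumr_ge0 => ? _); exact: sqr_ge0.
Qed.

Section enorm.
Context {R : realType} {d : nat}.
Implicit Types (x y z : 'rV[R]_d) (k : R).

Lemma enorm_ge0 x : 0 <= enorm x.
Proof. exact: sqrtr_ge0. Qed.

Lemma sqr_enorm x : enorm x ^+ 2 = \sum_(i < d) x ord0 i ^+ 2.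
Proof. by rewrite sqr_sqrtr// sumr_ge0// => i _; exact: sqr_ge0. Qed.

Lemma enormZ k x : enorm (k *: x) = `|k| * enorm x.
Proof.
rewrite /enorm -sqrtr_sqr -sqrtrM ?sqr_ge0// mulr_sumr.
by congr Num.sqrt; apply: eq_bigr => i _; rewrite mxE exprMn.
Qed.

Lemma enormN x : enorm (- x) = enorm x.
Proof. by rewrite -scaleN1r enormZ normrN1 mul1r. Qed.

Lemma enorm_distC x y : enorm (x - y) = enorm (y - x).
Proof. by rewrite -enormN opprB. Qed.

Lemma enorm0 : enorm (0 : 'rV[R]_d) = 0.
Proof. by rewrite -(scale0r 0) enormZ normr0 mul0r. Qed.

Lemma enormD x y : enorm (x + y) <= enorm x + enorm y.
Proof.
rewrite -(@ler_pXn2r _ 2)// ?nnegrE ?addr_ge0 ?enorm_ge0// sqrrD !sqr_enorm.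
have -> : \sum_(i < d) (x + y) ord0 i ^+ 2 = \sum_(i < d) x ord0 i ^+ 2 +
    (\sum_(i < d) x ord0 i * y ord0 i) *+ 2 + \sum_(i < d) y ord0 i ^+ 2.
  rewrite -sumrMnl -!big_split; apply: eq_bigr => i _.
  by rewrite mxE sqrrD.
rewrite lerD2r lerD2l lerMn2r/= -[leRHS]ger0_norm ?mulr_ge0 ?enorm_ge0//.
apply: le_trans (ler_norm _) _.
rewrite -(@ler_pXn2r _ 2)// ?nnegrE// !real_normK ?num_real//.
by rewrite exprMn !sqr_enorm; exact: sum_mul_sqr_le.
Qed.

Lemma enorm_triangle x y z : enorm (x - z) <= enorm (x - y) + enorm (y - z).
Proof. by rewrite -[x in leLHS](subrK y) -addrA; exact: enormD. Qed.

Lemma enorm_coord x (i : 'I_d) : `|x ord0 i| <= enorm x.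
Proof.
rewrite -(@ler_pXn2r _ 2)// ?nnegrE ?enorm_ge0// real_normK ?num_real//.
rewrite sqr_enorm (bigD1 i)//= lerDl sumr_ge0// => j _; exact: sqr_ge0.
Qed.

Lemma enorm_eq0 x : enorm x = 0 -> x = 0.
Proof.
move=> x0; apply/rowP => i; rewrite mxE; apply/eqP; rewrite -normr_eq0.
by rewrite eq_le normr_ge0 -x0 enorm_coord.
Qed.

Lemma enorm_le_sum x : enorm x <= \sum_i `|x ord0 i|.
Proof.
rewrite {1}(row_sum_delta x).
elim/big_ind2 : _ => [|u a v b ua vb|i _]; first by rewrite enorm0.
- by rewrite (le_trans (enormD _ _))// lerD.
- rewrite enormZ ler_piMr//.
  rewrite /enorm (bigD1 i)//= big1 => [|j /negbTE ji].
    by rewrite !mxE !eqxx addr0 expr1n sqrtr1.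
  by rewrite mxE ji andbF expr0n.
Qed.

Lemma rat_dense_enorm x k : 0 < k ->
  exists q : 'rV[rat]_d, enorm (x - map_mx ratr q) < k.
Proof.
(* Dividing by [d.+1] rather than [d] keeps the sum of the [d] coordinate errors strictly below [k],
   also when [d = 0]. *)
move=> k0; pose e : R := k / d.+1%:R.
have e0 : 0 < e by rewrite divr_gt0.
have /choice[q xq] (i : 'I_d) : exists q : rat, `|x ord0 i - ratr q| < e.
  have /rat_in_itvoo[q] : x ord0 i - e < x ord0 i + e by lra.
  by rewrite in_itv/= => qP; exists q; rewrite distrC ltr_distl.
exists (\row_i q i).
apply: le_lt_trans (enorm_le_sum _) _.
apply: (@le_lt_trans _ _ (\sum_(i < d) e)).
  by apply: ler_sum => i _; rewrite !mxE ltW// xq.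
have -> : k = e *+ d.+1 by rewrite -[RHS]mulr_natr divfK// pnatr_eq0.
by rewrite sumr_const card_ord mulrSr ltrDl.
Qed.

Lemma eball_sub (x y : 'rV[R]_d) (s t : R) : enorm (x - y) + s <= t ->
  eball x s `<=` eball y t.
Proof.
move=> st z; rewrite /eball/= => zx; apply: le_lt_trans (enorm_triangle z x y) _.
by apply: lt_le_trans st; rewrite addrC ltrD2l.
Qed.

End enorm.

(** * Measurability for the Lebesgue measure of R^d *)

Lemma measurable_fun_ltc (R : realType) d (T : measurableType d) (f : T -> R) :
  (forall t, measurable [set x | f x < t]) -> measurable_fun setT f.
Proof.
move=> mf; apply: (measurability _ (RGenInftyO.measurableE R)).
move=> _ [_ [t ->] <-]; rewrite setTI.
rewrite (_ : _ @^-1` _ = [set x | f x < t])//.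
Qed.

Section lebesgue_measure_Rd.
Context {R : realType} {d : nat}.
Local Notation V := 'rV[R]_d.
Local Notation outer := (@lebesgue_outer R d).
Local Notation leb := (@lebesgue_d R d).

Lemma box_content_box (a b : V) : (forall i, a ord0 i <= b ord0 i) ->
  (@box_content R d (box a b) <= (box_vol a b)%:E)%E.
Proof. by move=> ab; apply: ereal_inf_lbound; right; exists a, b. Qed.

Lemma outer_le_content (A : set (Rdisc R d)) :
  (outer A <= @box_content R d A)%E.
Proof.
apply: ereal_inf_lbound; exists (fun n => if n is 0%N then A else set0).
  by split=> // x Ax; exists 0%N.
rewrite (nneseries_split _ 1); last by move=> k _; exact: box_content_ge0.
rewrite add0n big_nat1 eseries0 ?adde0// => -[|k]//= _ _; exact: box_content0.
Qed.

Lemma outer_box_le (a b : V) : (forall i, a ord0 i <= b ord0 i) ->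
  (outer (box a b) <= (box_vol a b)%:E)%E.
Proof. by move=> ab; rewrite (le_trans (outer_le_content _))// box_content_box. Qed.

(** A cover of [X] by boxes pulls back to a cover of its preimage, so comparing outer measures under
    a map reduces to boxes. This serves for dilations, for [phi] and for its inverse. *)
Lemma outer_preimage_le (k : R) (g : V -> V) : 0 < k ->
  (forall a b : V, (forall i, a ord0 i <= b ord0 i) ->
    (outer (g @^-1` box a b) <= (k * box_vol a b)%:E)%E) ->
  forall X : set V, (outer (g @^-1` X) <= k%:E * outer X)%E.
Proof.
move=> k0 gbox X.
(* A set that is neither empty nor a box has content [+oo], so the bound extends from boxes to every
   member of a cover. *)
have gc (A : set V) : (outer (g @^-1` A) <= k%:E * @box_content R d A)%E.
  rewrite -lee_pdivrMl//; apply: le_ereal_inf_tmp => _ [[-> ->]|[a [b [ab [-> ->]]]]].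
    by rewrite preimage_set0 (outer_measure0 (@lebesgue_outer R d)) mule0.
  by rewrite lee_pdivrMl// -EFinM gbox.
rewrite -lee_pdivrMl//; apply: le_ereal_inf_tmp => _ [F [_ XF] <-].
rewrite lee_pdivrMl// -nneseriesZl; last by move=> n _; exact: box_content_ge0.
apply: (@le_trans _ _ (outer (\bigcup_n g @^-1` F n))).
  by apply: le_outer_measure => x /XF[n _ Fx]; exists n.
apply: le_trans (outer_measure_sigma_subadditive (@lebesgue_outer R d) _) _.
by apply: lee_nneseries => n _; rewrite ?outer_measure_ge0//; exact: gc.
Qed.

(** A hyperplane cuts a box into two closed boxes whose volumes add up. Cutting every member of a
    cover therefore costs nothing, which is the Caratheodory criterion. *)
Lemma measurable_halfspace (i : 'I_d) (t : R) :
  measurable ([set x | x ord0 i < t] : set (Rd R d)).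
Proof.
set H := [set x | _].
have cut (A : set V) :
    (outer (A `&` H) + outer (A `&` ~` H) <= @box_content R d A)%E.
  apply: le_ereal_inf_tmp => _ [[-> ->]|[a [b [ab [-> ->]]]]].
    by rewrite !set0I (outer_measure0 (@lebesgue_outer R d)) adde0.
  (* Clamping [t] to the [i]-th side treats all positions of the hyperplane at once; one of the two
     pieces may be degenerate. *)
  pose c := Num.min (Num.max t (a ord0 i)) (b ord0 i).
  have ac : a ord0 i <= c by rewrite le_min ab le_max lexx orbT.
  have cb : c <= b ord0 i by rewrite ge_min lexx orbT.
  pose b' : V := \row_j if j == i then c else b ord0 j.
  pose a' : V := \row_j if j == i then c else a ord0 j.
  have ab' j : a ord0 j <= b' ord0 j by rewrite mxE; case: eqP => [->|].
  have a'b j : a' ord0 j <= b ord0 j by rewrite mxE; case: eqP => [->|].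
  apply: (@le_trans _ _ (outer (box a b') + outer (box a' b))%E).
    apply: leeD; apply: le_outer_measure => x [abx Hx] j; have := abx j;
      rewrite mxE; case: eqP => // -> /andP[ax xb].
    - by rewrite ax /c le_min xb le_max (ltW Hx).
    - rewrite xb andbT /c ge_min ge_max ax andbT.
      by rewrite (_ : t <= _)// leNgt; apply/negP.
  apply: le_trans (leeD (outer_box_le ab') (outer_box_le a'b)) _.
  rewrite -EFinD lee_fin /box_vol (bigD1 i)//= [X in _ + X](bigD1 i)//=.
  rewrite [leRHS](bigD1 i)//= !mxE eqxx.
  under eq_bigr => j /negbTE ji do rewrite mxE ji.
  under [X in _ + _ * X]eq_bigr => j /negbTE ji do rewrite mxE ji.
  by rewrite -mulrDl (addrC (c - _)) subrKA.
apply: le_caratheodory_measurable => X.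
apply: le_ereal_inf_tmp => _ [F [_ XF] <-].
apply: (@le_trans _ _ (outer (\bigcup_n (F n `&` H)) +
    outer (\bigcup_n (F n `&` ~` H)))%E).
  by apply: leeD; apply: le_outer_measure => x [/XF[n _ Fx] Hx]; exists n.
apply: le_trans (leeD (outer_measure_sigma_subadditive (@lebesgue_outer R d) _)
  (outer_measure_sigma_subadditive (@lebesgue_outer R d) _)) _.
rewrite -nneseriesD; do ?by move=> *; exact: outer_measure_ge0.
apply: lee_nneseries => n _; last exact: cut.
by rewrite adde_ge0// outer_measure_ge0.
Qed.

Lemma measurable_coord (i : 'I_d) :
  measurable_fun [set: Rd R d] (fun x : Rd R d => x ord0 i).
Proof.
by apply: measurable_fun_ltc => t; exact: measurable_halfspace.
Qed.

Lemma measurable_sqrt (D : set R) : measurable_fun D (@Num.sqrt R).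
Proof.
apply: measurable_funTS; apply: continuous_measurable_fun; exact: sqrt_continuous.
Qed.

Lemma measurable_enorm d' (T : measurableType d') (g : T -> V) :
  (forall i, measurable_fun setT (fun x => g x ord0 i)) ->
  measurable_fun setT (fun x => enorm (g x)).
Proof.
move=> mg; apply: measurableT_comp; first exact: measurable_sqrt.
by apply: measurable_sum => i; exact: measurable_funX.
Qed.

Lemma measurable_enorm_sub (c : V) :
  measurable_fun [set: Rd R d] (fun x : Rd R d => enorm ((x : V) - c)).
Proof.
apply: measurable_enorm => i; under eq_fun do rewrite !mxE.
apply: measurable_funB; [exact: measurable_coord|exact: measurable_cst].
Qed.

Lemma measurable_ltr d' (T : measurableType d') (f g : T -> R) :
  measurable_fun setT f -> measurable_fun setT g ->
  measurable [set x | f x < g x].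
Proof.
move=> mf mg; rewrite -[X in measurable X]setTI.
exact: (measurable_fun_ltr mf mg).
Qed.

Lemma measurable_eball (c : V) (r : R) : measurable (eball c r : set (Rd R d)).
Proof.
by apply: measurable_ltr; [exact: measurable_enorm_sub|exact: measurable_cst].
Qed.

(* A Lipschitz function is the infimum of the functions
   [x |-> g q + L * enorm (x - q)] over the rational points [q]. *)
Lemma measurable_lipschitz (L : R) (g : V -> R) : 0 <= L ->
  (forall x y, g x <= g y + L * enorm (x - y)) ->
  measurable_fun [set: Rd R d] (g : Rd R d -> R).
Proof.
move=> L0 gL; apply: measurable_fun_ltc => t.
rewrite (_ : [set x | _] = \bigcup_(q : 'rV[rat]_d)
    [set x | g (map_mx ratr q) + L * enorm (x - map_mx ratr q) < t]).
  apply: countable_bigcupT_measurable; first exact: countableP.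
  move=> q; apply: measurable_ltr; last exact: measurable_cst.
  apply: measurable_funD; first exact: measurable_cst.
  apply: measurable_funM; [exact: measurable_cst|exact: measurable_enorm_sub].
apply/seteqP; split => x /=; last first.
  by move=> [q _]; apply: le_lt_trans.
(* Going from [x] to [q] and back costs at most [2 * L] times their distance; the added [1] keeps
   the denominator positive when [L = 0]. *)
move=> gxt; have e0 : 0 < (t - g x) / (2 * L + 1).
  by rewrite divr_gt0 ?subr_gt0// ltr_wpDl// mulr_ge0.
have [q qx] := rat_dense_enorm x e0; exists q => //=.
move: qx; rewrite ltr_pdivlMr; last by rewrite ltr_wpDl// mulr_ge0.
have := gL (map_mx ratr q) x; rewrite enorm_distC.
have := enorm_ge0 (x - map_mx ratr q); nra.
Qed.

End lebesgue_measure_Rd.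

(** * Volumes of Euclidean balls *)

Section volume_of_balls.
Context {R : realType} {d : nat}.
Local Notation V := 'rV[R]_d.
Local Notation outer := (@lebesgue_outer R d).
Local Notation leb := (@lebesgue_d R d).

Lemma outer_affine_preimage_le (k : R) (v : V) (X : set V) : 0 < k ->
  (outer ((fun x : V => k *: x + v)%R @^-1` X) <= (k^-1 ^+ d)%:E * outer X)%E.
Proof.
move=> k0; apply: outer_preimage_le => [|a b ab].
  by rewrite exprn_gt0// invr_gt0.
have sub : (fun x : V => k *: x + v) @^-1` box a b `<=`
    box (k^-1 *: (a - v)) (k^-1 *: (b - v)).
  move=> x /= abx i; rewrite !mxE; have := abx i; rewrite !mxE => /andP[ax xb].
  by rewrite ler_pdivrMl// ler_pdivlMl// lerBlDr lerBrDr ax xb.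
apply: (le_trans (@le_outer_measure _ _ outer _ _ sub)).
apply: le_trans (outer_box_le _) _ => [i|].
  by rewrite !mxE ler_pM2l ?invr_gt0// lerD2r.
rewrite lee_fin /box_vol.
rewrite [X in _ ^+ X](_ : d = #|'I_d|); last by rewrite card_ord.
rewrite -prodr_const -big_split/= le_eqVlt; apply/orP; left; apply/eqP.
by apply: eq_bigr => i _; rewrite !mxE -mulrBr opprB addrA subrK.
Qed.

(** Kept symbolic: averages only involve ratios of volumes, in which this constant cancels when it
    is positive. *)
Definition unit_volume : R := fine (leb (eball 0 1)).

Lemma outer_unit_ball_fin : (outer (eball 0 1) < +oo)%E.
Proof.
have sub : eball 0 1 `<=` box (- const_mx 1 : V) (const_mx 1).
  move=> x; rewrite /eball/= subr0 => x1 i; rewrite !mxE -ler_norml.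
  by rewrite (le_trans (enorm_coord _ _))// ltW.
apply: (le_lt_trans (@le_outer_measure _ _ outer _ _ sub)).
apply: le_lt_trans (outer_box_le _) (ltry _) => i.
by rewrite !mxE; lra.
Qed.

Lemma unit_volume_ge0 : 0 <= unit_volume.
Proof. by rewrite fine_ge0// outer_measure_ge0. Qed.

(** The one-sided bound on affine preimages, applied to a dilation and to its inverse, gives both
    inequalities. *)
Lemma lebesgue_eball (c : V) (r : R) : 0 < r ->
  leb (eball c r) = (unit_volume * r ^+ d)%:E.
Proof.
move=> r0; rewrite EFinM fineK; last first.
  by rewrite ge0_fin_numE ?outer_measure_ge0// outer_unit_ball_fin.
have E1 : eball c r = (fun x : V => r^-1 *: x + r^-1 *: - c) @^-1` eball 0 1.
  apply/seteqP; split => x; rewrite /eball/= subr0 -scalerDr enormZ ger0_norm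
    ?invr_ge0 ?ltW// ltr_pdivrMl// mulr1//.
have E2 : eball 0 1 = (fun x : V => r *: x + c) @^-1` eball c r.
  apply/seteqP; split => x; rewrite /eball/= subr0 addrK enormZ ger0_norm
    ?ltW// gtr_pMr//.
apply/eqP; rewrite eq_le muleC; apply/andP; split.
  have := @outer_affine_preimage_le r^-1 (r^-1 *: - c) (eball 0 1).
  by rewrite invr_gt0 invrK -E1; apply.
rewrite -lee_pdivlMl ?exprn_gt0// {1}E2 -exprVn.
exact: outer_affine_preimage_le.
Qed.

Lemma eball0 (c : V) : eball c 0 = set0.
Proof.
by apply/seteqP; split => x //; rewrite /eball/= => /lt_geF; rewrite enorm_ge0.
Qed.

(** Prepares the use of Tonelli's theorem for the averaging kernel. *)
Lemma lebesgue_sigma_finite : sigma_finite [set: Rd R d] leb.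
Proof.
exists (fun n => eball 0 n.+1%:R).
  apply/seteqP; split => // x _; exists (Num.truncn (enorm x)) => //=.
  by rewrite /eball/= subr0 truncnS_gt.
by move=> n; split; [exact: measurable_eball|rewrite lebesgue_eball// ltry].
Qed.

HB.instance Definition _ := Measure_isSigmaFinite.Build _ (Rd R d) R leb
  lebesgue_sigma_finite.

End volume_of_balls.

(** * Change of variables under a measure-preserving map *)

Section measure_preserving.
Context {R : realType} {d : nat}.
Local Notation V := 'rV[R]_d.
Local Notation outer := (@lebesgue_outer R d).
Local Notation leb := (@lebesgue_d R d).

Variables (phi : V -> V) (K : R).
Hypotheses (bphi : bijective phi) (pphi : preserves_lebesgue phi)
  (K0 : 0 <= K) (phiK : forall x y, enorm (phi x - phi y) <= K * enorm (x - y)).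

Lemma measurable_lipschitz_coord (i : 'I_d) :
  measurable_fun [set: Rd R d] (fun x : Rd R d => phi x ord0 i).
Proof.
apply: (measurable_lipschitz K0) => x y; rewrite -lerBlDl.
apply: le_trans (phiK x y); apply: le_trans (enorm_coord _ i).
by rewrite !mxE ler_norm.
Qed.

Lemma measurable_coord_box d' (T : measurableType d') (g : T -> V) (a b : V) :
  (forall i, measurable_fun setT (fun x => g x ord0 i)) ->
  measurable (g @^-1` box a b).
Proof.
move=> mg; rewrite (_ : _ @^-1` _ = \bigcap_(i : 'I_d)
  (~` [set x | g x ord0 i < a ord0 i] `&` ~` [set x | b ord0 i < g x ord0 i])).
  apply: fin_bigcap_measurable => // i _.
  by apply: measurableI; apply: measurableC; exact: measurable_ltr.
apply/seteqP; split => x /= abx i; have := abx i.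
  by move=> /andP[? ?] _; split; apply/negP; rewrite -leNgt.
by move=> /(_ I)[/negP + /negP]; rewrite -!leNgt => -> ->.
Qed.

(** Passes from images of measurable sets, as in [preserves_lebesgue], to preimages of arbitrary
    sets. By [outer_preimage_le] it suffices to treat boxes: the preimage of a box under [phi] is
    measurable and has image in that box, and the preimage of a box under [psi] is its image under
    [phi]. *)
Lemma outer_preimage_phi (X : set V) : outer (phi @^-1` X) = outer X.
Proof.
have [psi phiK1 psiK] := bphi.
have imE (A : set V) : phi @` A = psi @^-1` A.
  apply/seteqP; split => [_ [x Ax <-]|x Ax]/=; first by rewrite phiK1.
  by exists (psi x); rewrite ?psiK.
apply/eqP; rewrite eq_le; apply/andP; split.
  rewrite -[leRHS]mul1e; apply: outer_preimage_le => // a b ab; rewrite mul1r.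
  rewrite -[leLHS](pphi (measurable_coord_box a b measurable_lipschitz_coord)).
  rewrite imE; apply: le_trans (outer_box_le ab).
  by apply: le_outer_measure => x /=; rewrite psiK.
have {1}-> : X = psi @^-1` (phi @^-1` X).
  by apply/seteqP; split => x /=; rewrite psiK.
rewrite -[leRHS]mul1e; apply: outer_preimage_le => // a b ab; rewrite mul1r.
rewrite -imE [leLHS](pphi (measurable_coord_box a b measurable_coord)).
exact: outer_box_le.
Qed.

(** The Caratheodory criterion only involves the outer measure, which [phi] preserves on all sets.
    Testing the preimage of [A] on [X] thus amounts to testing [A] on the image of [X]. This covers
    every Lebesgue measurable [A], beyond Borel sets. *)
Lemma measurable_phi : measurable_fun [set: Rd R d] (phi : Rd R d -> Rd R d).
Proof.
move=> _ A mA; rewrite setTI; have [psi phiK1 psiK] := bphi.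
apply: le_caratheodory_measurable => X.
have E (B : set V) : outer (X `&` phi @^-1` B) = outer (psi @^-1` X `&` B).
  rewrite -[RHS]outer_preimage_phi; congr (outer _).
  by apply/seteqP; split => x /=; rewrite /setI/preimage/= phiK1.
apply: le_trans (_ : _ <= outer (psi @^-1` X))%E _; last first.
  by rewrite -outer_preimage_phi; apply: le_outer_measure => x /=; rewrite phiK1.
rewrite [leRHS](mA (psi @^-1` X)); apply: leeD;
  rewrite le_eqVlt; apply/orP; left; apply/eqP; [exact: E A|exact: E (~` A)].
Qed.

Lemma integral_comp_phi (D : set (Rd R d)) (F : Rd R d -> \bar R) :
  measurable D -> measurable_fun D F -> (forall x, D x -> (0 <= F x)%E) ->
  (\int[leb]_(x in phi @^-1` D) F (phi x) = \int[leb]_(x in D) F x)%E.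
Proof.
move=> mD mF F0.
rewrite -[LHS](ge0_integral_pushforward measurable_phi leb mD mF); last first.
  by move=> y /set_mem; exact: F0.
apply: eq_measure_integral => [|? A mA _]; first exact: measurable_phi.
exact: outer_preimage_phi.
Qed.

End measure_preserving.

(** * Averages and convexity *)

Section powR_convexity.
Context {R : realType}.
Implicit Types p x y A t : R.

Lemma powRD_le p x y : 0 <= p -> 0 <= x -> 0 <= y ->
  (x + y) `^ p <= 2 `^ p * (x `^ p + y `^ p).
Proof.
move=> p0; wlog xy : x y / x <= y => [H x0 y0|x0 y0].
  by have [/H|/ltW/H] := leP x y; [|rewrite addrC (addrC (_ `^ _))]; apply.
apply: (@le_trans _ _ (2 `^ p * y `^ p)).
  by rewrite -powRM// ge0_ler_powR// ?nnegrE; lra.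
by rewrite ler_wpM2l ?powR_ge0// lerDr powR_ge0.
Qed.

(** Convexity: the graph of the [p]-th power lies above its tangent at [A]. The terms are arranged
    so that both sides are nonnegative and can be integrated as such. *)
Lemma powR_tangent p A t : 1 <= p -> 0 <= A -> 0 <= t ->
  A `^ p + p * A `^ (p - 1) * t <= t `^ p + p * A `^ p.
Proof.
(* For [p = 1] there is no finite conjugate exponent; for [p > 1] the claim is Young's inequality
   with exponents [p] and [p / (p - 1)]. *)
rewrite le_eqVlt => /predU1P[<-|p1] A0 t0.
  by rewrite subrr powRr0 !powRr1// !mul1r addrC.
have p0 : 0 < p := lt_trans ltr01 p1.
have q0 : 0 < p / (p - 1) by rewrite divr_gt0; lra.
have := @conjugate_powR _ t (A `^ (p - 1)) p (p / (p - 1)) t0 (powR_ge0 _ _) p0 q0.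
rewrite -powRrM (_ : (p - 1) * (p / (p - 1)) = p); last by (field; lra).
have -> : p^-1 + (p / (p - 1))^-1 = 1 by field; lra.
move=> /(_ erefl); rewrite -(ler_pM2l p0).
have -> : p * (t `^ p / p + A `^ p / (p / (p - 1))) = t `^ p + (p - 1) * A `^ p.
  by field; lra.
lra.
Qed.

End powR_convexity.

Section averages.
Context {d : measure_display} {T : measurableType d} {R : realType}.
Variables (mu : {measure set T -> \bar R}) (D : set T) (m p : R).
Hypotheses (mD : measurable D) (muD : mu D = m%:E) (m0 : 0 < m) (p1 : 1 <= p).

Lemma measurable_powR_norm (g : T -> R) : measurable_fun D g ->
  measurable_fun D (fun x => (`|g x| `^ p)%:E).
Proof.
move=> mg; apply/measurable_EFinP; apply: (measurableT_comp (measurable_powR p)).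
exact: measurableT_comp.
Qed.

Lemma integral_const (k : R) : (\int[mu]_(x in D) k%:E = (k * m)%:E)%E.
Proof. by rewrite integral_cst// muD. Qed.

(** Jensen's inequality, by integrating the tangent inequality at the modulus [A] of the average,
    which is at most the average of the modulus. *)
Lemma powR_average_le (g : T -> R) : mu.-integrable D (EFin \o g) ->
  ((m * `|m^-1 * Rintegral mu D g| `^ p)%:E <= \int[mu]_(x in D) (`|g x| `^ p)%:E)%E.
Proof.
have p0 : 0 < p := lt_le_trans ltr01 p1.
move=> ig; set A : R := `|_|; have A0 : 0 <= A by exact: normr_ge0.
have mg : measurable_fun D g by apply/measurable_EFinP; exact: measurable_int ig.
have mng : measurable_fun D (fun x => `|g x|%:E).
  by apply/measurable_EFinP; exact: measurableT_comp.
have Ag : ((A * m)%:E <= \int[mu]_(x in D) `|g x|%:E)%E.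
  rewrite /A normrM ger0_norm ?invr_ge0 ?(ltW m0)// mulrC mulrA divff ?gt_eqF// mul1r.
  have fg : (\int[mu]_(x in D) (g x)%:E)%E \is a fin_num by exact: integrable_fin_num.
  rewrite -abse_EFin /Rintegral fineK//.
  by apply: le_abse_integral => //; exact: measurable_int ig.
pose k := p * A `^ (p - 1); have k0 : 0 <= k by rewrite mulr_ge0 ?powR_ge0// ltW.
(* This finite term is added to both sides to match [powR_tangent], so that all integrands are
   nonnegative. *)
have cfin : (p * A `^ p * m)%:E \is a fin_num by [].
rewrite -(leeD2rE _ _ cfin).
apply: (@le_trans _ _ (\int[mu]_(x in D) ((A `^ p)%:E + k%:E * `|g x|%:E))%E).
  rewrite ge0_integralD//=; last 3 first.
  - by move=> x _; rewrite lee_fin powR_ge0.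
  - by move=> x _; rewrite lee_fin mulr_ge0.
  - by apply: measurable_funeM.
  rewrite integral_const ge0_integralZl//.
  rewrite (mulrC m); apply: leeD => //.
  apply: le_trans (lee_wpmul2l _ Ag); last by rewrite lee_fin.
  by rewrite -EFinM lee_fin /k !mulrA -(mulrA p _ A) (mulrC _ A) mulr_powRB1.
apply: (@le_trans _ _ (\int[mu]_(x in D) ((`|g x| `^ p)%:E + (p * A `^ p)%:E))%E).
  apply: ge0_le_integral => //.
  - by move=> x _; rewrite adde_ge0 ?lee_fin ?powR_ge0// mulr_ge0.
  - by apply: emeasurable_funD => //; exact: measurable_funeM.
  - by apply: emeasurable_funD => //; exact: measurable_powR_norm.
  - by move=> x _; rewrite -EFinM -!EFinD lee_fin powR_tangent.
rewrite ge0_integralD//=.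
- by rewrite integral_const.
- exact: measurable_powR_norm.
- by move=> x _; rewrite lee_fin mulr_ge0 ?powR_ge0// ltW.
Qed.

Lemma integral_powR_sub_le (g : T -> R) (s t : R) : measurable_fun D g ->
  (\int[mu]_(x in D) (`|g x - s| `^ p)%:E <=
   (2 `^ p)%:E * (\int[mu]_(x in D) (`|g x - t| `^ p)%:E + (m * `|t - s| `^ p)%:E))%E.
Proof.
move=> mg; have p0 : 0 <= p := le_trans ler01 p1.
have mt (r : R) : measurable_fun D (fun x => (`|g x - r| `^ p)%:E).
  by apply: measurable_powR_norm; exact: measurable_funB.
have pos (r : R) x : D x -> (0 <= (`|g x - r| `^ p)%:E)%E.
  by rewrite lee_fin powR_ge0.
rewrite mulrC -integral_const -ge0_integralD//=.
rewrite -ge0_integralZl//=; last 2 first.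
- exact: emeasurable_funD.
- by move=> x _; rewrite lee_fin addr_ge0 ?powR_ge0.
apply: ge0_le_integral => //.
- by apply: measurable_funeM; apply: emeasurable_funD.
- move=> x _; rewrite -EFinD -EFinM lee_fin; apply: le_trans (powRD_le _ _ _) => //.
  by rewrite ge0_ler_powR ?nnegrE ?addr_ge0//; exact: ler_distD.
Qed.

Lemma average_sub (g : T -> R) (k : R) : mu.-integrable D (EFin \o g) ->
  mu.-integrable D (EFin \o (fun x => g x - k)) /\
  m^-1 * Rintegral mu D (fun x => g x - k) = m^-1 * Rintegral mu D g - k.
Proof.
move=> ig; have ik : mu.-integrable D (EFin \o cst k).
  apply/integrableP; split; first by apply/measurable_EFinP.
  under eq_integral do rewrite /=.
  by rewrite integral_const ltry.
split; first by apply: (eq_integrable mD _ _ _ (integrableB mD ig ik)).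
rewrite RintegralB// mulrBr; congr (_ - _).
by rewrite Rintegral_cst// muD/= mulrCA mulVf ?gt_eqF// mulr1.
Qed.

(** Up to a constant, the average is the best constant to subtract: by Jensen its distance to [k] is
    controlled by the mean of the [p]-th power of [g - k]. Hence the average of the composition may
    later be replaced by an average of [f] itself. *)
Lemma integral_powR_sub_average_le (g : T -> R) (k : R) :
  mu.-integrable D (EFin \o g) ->
  (\int[mu]_(x in D) (`|g x - m^-1 * Rintegral mu D g| `^ p)%:E <=
   (2 `^ p * 2)%:E * \int[mu]_(x in D) (`|g x - k| `^ p)%:E)%E.
Proof.
move=> ig; have [igk gk] := average_sub k ig.
have mg : measurable_fun D g by apply/measurable_EFinP; exact: measurable_int ig.
apply: le_trans (integral_powR_sub_le _ k mg) _.
rewrite (EFinM _ 2) -muleA lee_wpmul2l ?lee_fin ?powR_ge0//.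
rewrite mule_natl mule2n leeD2l// distrC -gk; exact: powR_average_le.
Qed.

End averages.

(** * Thin shells and the integral of the depth in a ball *)

Lemma geometric_nneseries_le (R : realType) (k : R) : 0 <= k ->
  (\sum_(0 <= j <oo) (k / 2 ^+ j)%:E <= (2 * k)%:E)%E.
Proof.
move=> k0; apply: lime_le.
  by apply: is_cvg_nneseries => n _ _; rewrite lee_fin divr_ge0// exprn_ge0.
apply: nearW => n; rewrite sumEFin lee_fin.
have -> : \sum_(0 <= j < n) k / 2 ^+ j = 2 * k - 2 * k / 2 ^+ n.
  elim: n => [|n IHn]; first by rewrite big_nil expr0 divr1 subrr.
  rewrite big_nat_recr//= IHn exprS; field.
  by rewrite expf_neq0// pnatr_eq0.
by rewrite gerBl divr_ge0 ?exprn_ge0 ?mulr_ge0.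
Qed.

(** Bernoulli's inequality. *)
Lemma one_sub_exprn_le (R : realType) (e : R) (n : nat) : 0 <= e <= 1 ->
  1 - (1 - e) ^+ n <= n%:R * e.
Proof.
move=> /andP[e0 e1]; elim: n => [|n IHn]; first by rewrite expr0 subrr mul0r.
have : 0 <= (1 - e) ^+ n <= 1.
  by rewrite exprn_ge0 ?exprn_ile1 ?subr_ge0// gerBl.
by rewrite exprS -natr1; nra.
Qed.

Section shells.
Context {R : realType} {d : nat}.
Hypothesis d0 : (0 < d)%N.
Local Notation V := 'rV[R]_d.
Local Notation leb := (@lebesgue_d R d).
Local Notation omega := (@unit_volume R d).

(** At [r = 0] the ball is empty, and [0 < d] excludes [0 ^+ 0 = 1] on the right. *)
Lemma lebesgue_eball_ge0 (c : V) (r : R) : 0 <= r ->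
  leb (eball c r) = (omega * r ^+ d)%:E.
Proof.
rewrite le_eqVlt => /predU1P[<-|/lebesgue_eball//].
by rewrite eball0 measure0 expr0n gtn_eqF// mulr0.
Qed.

Lemma lebesgue_shell_le (c : V) (r e : R) : 0 < r -> 0 <= e <= 1 ->
  (leb (eball c r `\` eball c (r * (1 - e))) <= (d%:R * e * (omega * r ^+ d))%:E)%E.
Proof.
move=> r0 e01; have /andP[e0 e1] := e01.
have sub : eball c (r * (1 - e)) `<=` eball c r.
  by apply: eball_sub; rewrite subrr enorm0 add0r ger_pMr// gerBl.
have fin : (leb (eball c r) < +oo)%E by rewrite lebesgue_eball// ltry.
rewrite [leLHS](measureD (measurable_eball c r) (measurable_eball _ _) fin).
rewrite setIidr// [X in (X - _)%E](lebesgue_eball c r0).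
rewrite [X in (_ - X)%E]lebesgue_eball_ge0; last first.
  by rewrite mulr_ge0 ?subr_ge0// ltW.
rewrite -EFinB lee_fin exprMn.
have -> : omega * r ^+ d - omega * (r ^+ d * (1 - e) ^+ d) =
    (1 - (1 - e) ^+ d) * (omega * r ^+ d) by ring.
rewrite ler_wpM2r ?one_sub_exprn_le//.
by rewrite mulr_ge0 ?unit_volume_ge0// exprn_ge0// ltW.
Qed.

(** Dyadic decomposition by the depth [u]. Where [u] lies between [4^-(j+1)] and [4^-j], its power
    -1/2 is at most [2^(j+1)], while the shell [u <= 4^-j] has at most [d * 4^-j] times the volume
    of the ball. The products [2 * d * 2^-j] sum to [4 * d]. *)
Lemma integral_depth_le (c : V) (r : R) : 0 < r ->
  (\int[leb]_(w in (eball c r : set (Rd R d)))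
     ((1 - enorm ((w : V) - c) / r) `^ (- 2^-1))%:E <=
   (4 * d%:R * (omega * r ^+ d))%:E)%E.
Proof.
move=> r0; pose u (w : V) := 1 - enorm (w - c) / r.
have mu : measurable_fun [set: Rd R d] (u : Rd R d -> R).
  apply: measurable_funB; first exact: measurable_cst.
  apply: measurable_funM; [exact: measurable_enorm_sub|exact: measurable_cst].
pose S (j : nat) : set (Rd R d) := eball c r `\` eball c (r * (1 - 4^-1 ^+ j)).
have mS j : measurable (S j) by apply: measurableD; exact: measurable_eball.
have uS j (w : V) : eball c r w -> u w <= 4^-1 ^+ j -> S j w.
  move=> cw uw; split=> //; apply/negP; rewrite -leNgt mulrC -ler_pdivlMr//.
  by move: uw; rewrite /u; lra.
(* The sets [S j] are nested rather than disjoint: at each point one term of the series suffices and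
   the others are nonnegative. *)
pose h j (w : Rd R d) : \bar R := ((2 ^+ j.+1) * \1_(S j) w)%:E.
have mh j : measurable_fun [set: Rd R d] (h j).
  by apply/measurable_EFinP; apply: measurable_funM => //; exact: measurable_indic.
have h0 j w : (0 <= h j w)%E by rewrite lee_fin mulr_ge0.
apply: (@le_trans _ _ (\int[leb]_(w in (eball c r : set (Rd R d)))
    \sum_(0 <= j <oo) h j w)%E).
  apply: ge0_le_integral; first exact: measurable_eball.
  - by move=> w _; rewrite lee_fin powR_ge0.
  - apply/measurable_EFinP; apply: measurable_funTS.
    by apply: (measurableT_comp (measurable_powR _)).
  - by apply: measurable_funTS; exact: ge0_emeasurable_sum.
  move=> w cw; rewrite -/(u w); have uw0 : 0 < u w by rewrite subr_gt0 ltr_pdivrMr// mul1r.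
  have ex_n : exists n, 4^-1 ^+ n < u w.
    exists (Num.truncn (u w)^-1).+1.
    rewrite exprVn invf_plt ?posrE ?exprn_gt0//.
    apply: lt_le_trans (truncnS_gt _) _.
    by rewrite -natrX ler_nat ltnW// ltn_expl.
  (* The least such exponent is positive because [u w <= 1]; its predecessor [j] indexes the dyadic
     layer of [w]. *)
  case: (ex_minnP ex_n) => -[|j].
    by rewrite expr0 /u ltNge gerBl divr_ge0 ?enorm_ge0 ?(ltW r0).
  move=> uj minj; have uj' : u w <= 4^-1 ^+ j.
    by rewrite leNgt; apply/negP => /minj; rewrite ltnn.
  apply: le_trans (nneseries_lim_ge j.+1 _) => //.
  rewrite big_nat_recr//=; apply: le_trans (leeDr _ _); last first.
    by apply: sume_ge0.
  rewrite /h indicE mem_set; last exact: uS.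
  rewrite mulr1 lee_fin powRN powR12_sqrt ?(ltW uw0)// -[leRHS]invrK.
  rewrite lef_pV2 ?posrE ?sqrtr_gt0 ?invr_gt0 ?exprn_gt0//.
  rewrite -(@ler_pXn2r _ 2)// ?nnegrE ?sqrtr_ge0 ?invr_ge0 ?exprn_ge0// sqr_sqrtr ?(ltW uw0)//.
  by rewrite exprVn -exprM mulnC exprM -exprVn -natrX ltW.
rewrite integral_nneseries//; last 2 first.
  exact: measurable_eball.
  by move=> j; exact: measurable_funTS.
have -> : 4 * d%:R * (omega * r ^+ d) = 2 * (2 * d%:R * (omega * r ^+ d)) by ring.
apply: le_trans (geometric_nneseries_le _); last first.
  by rewrite !mulr_ge0 ?unit_volume_ge0// exprn_ge0// ltW.
apply: lee_nneseries => j _; first by move=> _; apply: integral_ge0 => w _; exact: h0.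
under eq_integral do rewrite /h EFinM.
rewrite ge0_integralZl//; last 2 first.
- exact: measurable_eball.
- by apply/measurable_EFinP; apply: measurable_funTS; exact: measurable_indic.
rewrite integral_indic//; last exact: measurable_eball.
rewrite setIidl; last by move=> w [].
apply: le_trans (lee_wpmul2l _ (lebesgue_shell_le _ r0 _)) _ => //.
  by rewrite exprn_ge0//= exprn_ile1// invf_le1// ler1n.
rewrite -EFinM lee_fin exprS exprVn (_ : 4 = 2 * 2) ?exprMn; last by ring.
rewrite le_eqVlt; apply/orP; left; apply/eqP; field.
by rewrite expf_neq0// pnatr_eq0.
Qed.

End shells.

(** * Telescoping averages over concentric balls *)

Lemma ln_le_pred (R : realType) (x : R) : 0 < x -> ln x <= x - 1.
Proof. by move=> x0; have := @le_ln1Dx R (x - 1); rewrite subrKC; apply; lra. Qed.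

(* [Psi s] dominates [|f_B(x,s) - f_B(y,2T)|] by telescoping over the doublings
   of [s] up to [T = K * r]; it grows logarithmically for [a = 0] and is
   bounded by a geometric sum for [a > 0]. *)
Lemma doubling_majorant (R : realType) (p a : R) : 1 <= p -> 0 <= a ->
  exists2 C : R, 0 < C & forall K r : R, 2 <= K -> 0 < r ->
    exists Psi : R -> R,
    [/\ forall s, 0 < s -> s <= K * r -> (2 * (K * r)) `^ a <= Psi s,
        forall s, 0 < s -> 2 * s <= K * r -> (2 * s) `^ a + Psi (2 * s) <= Psi s &
        forall u, 0 < u -> u <= 1 ->
          Psi (u * r / (4 * K)) <= C * rho a K * r `^ a * u `^ (- (2 * p)^-1)].
Proof.
move=> p1 a0.
have p20 : 0 < 2 * p by lra.
have u1 (u : R) : 0 < u -> u <= 1 -> 1 <= u `^ (- (2 * p)^-1).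
  move=> u0 u1; rewrite -[leLHS](powRr0 u); apply: ger_powR; rewrite ?u0//.
  by rewrite oppr_le0 invr_ge0 ltW.
have [->|an0] := eqVneq a 0.
  have l20 : 0 < ln 2 :> R by rewrite ln_gt0// ltr1n.
  exists (5 / ln 2 + 2 * p / ln 2 ^+ 2) => [|K r K2 r0].
    by rewrite addr_gt0// divr_gt0// exprn_gt0.
  have K0 : 0 < K by lra.
  have Kr0 : 0 < K * r by rewrite mulr_gt0.
  (* Each doubling costs 1 when [a = 0]: the quotient of logarithms counts the doublings from [s] to
     [K * r], and the leading 1 pays for the last step. *)
  exists (fun s => 1 + ln (K * r / s) / ln 2); split => [s s0 sK|s s0 sK|u u0 ule].
  - rewrite powRr0 lerDl divr_ge0 ?(ltW l20)// ln_ge0//.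
    by rewrite ler_pdivlMr// mul1r.
  - rewrite powRr0 -[ln (K * r / s)](_ : ln 2 + ln (K * r / (2 * s)) = _).
      by rewrite (mulrDl (ln 2)) divff ?gt_eqF// addrA.
    rewrite -lnM ?posrE ?divr_gt0// ?mulr_gt0//; congr ln; field; lra.
  - set v := u `^ _; have v1 : 1 <= v by exact: u1.
    rewrite /rho eqxx powRr0 mulr1.
    have -> : K * r / (u * r / (4 * K)) = 2 * 2 * (K * K) * u^-1 by field; lra.
    rewrite !lnM ?posrE ?mulr_gt0 ?invr_gt0// lnV ?posrE//.
    (* The logarithm of the depth is absorbed by the small negative power [v], through
       [ln v <= v - 1]. *)
    have lv : - ln u <= 2 * p * v.
      have -> : - ln u = 2 * p * ln v by rewrite ln_powR; field; lra.
      by rewrite ler_pM2l//; have := @ln_le_pred R v; lra.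
    (* Because [K >= 2], additive constants can be absorbed into multiples of [ln K]. *)
    have lK : ln 2 <= ln K by rewrite ler_ln ?posrE.
    move: lv v1; set m := - ln u => lv v1.
    pose t := ln K / ln 2; have t1 : 1 <= t by rewrite ler_pdivlMr// mul1r.
    have tv : v <= t * v by rewrite ler_peMl//; lra.
    have tt : t <= t * v by rewrite ler_peMr//; lra.
    apply: (@le_trans _ _ (5 * (t * v) + 2 * p * (t * v) / ln 2)); last first.
      by rewrite le_eqVlt; apply/orP; left; apply/eqP; rewrite /t; field; lra.
    have -> : 1 + (ln 2 + ln 2 + (ln K + ln K) + m) / ln 2 = 3 + 2 * t + m / ln 2.
      by rewrite /t; field; lra.
    apply: lerD; first by lra.
    by rewrite ler_pM2r ?invr_gt0// (le_trans lv)// ler_pM2l.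
have a00 : 0 < a by rewrite lt_neqAle eq_sym an0.
pose b : R := 2 `^ a - 1.
have b0 : 0 < b.
  rewrite subr_gt0 -[ltLHS](powRr0 2) /powR !pnatr_eq0/= ltr_expR mul0r.
  by rewrite mulr_gt0// ln_gt0// ltr1n.
exists (2 `^ a * (1 + b^-1)) => [|K r K2 r0].
  by rewrite mulr_gt0 ?powR_gt0// addr_gt0// invr_gt0.
have K0 : 0 < K by lra.
have Kr0 : 0 < K * r by rewrite mulr_gt0.
(* Closed form of a geometric sum: with [b = 2^a - 1], the difference of the values at [s] and
   [2 * s] is exactly [(2 * s)^a]. *)
exists (fun s => (2 * (K * r)) `^ a * (1 + b^-1) - (2 * s) `^ a / b).
split => [s s0 sK|s s0 sK|u u0 ule].
- rewrite mulrDr mulr1 -addrA lerDl subr_ge0 ler_pM2r ?invr_gt0//.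
  by rewrite ge0_ler_powR ?nnegrE// ?mulr_ge0 ?ler_pM2l// ltW.
- have -> : (2 * (2 * s)) `^ a = (1 + b) * (2 * s) `^ a.
    by rewrite subrKC powRM// mulr_ge0// ltW.
  rewrite le_eqVlt; apply/orP; left; apply/eqP; field; lra.
- apply: (@le_trans _ _ ((2 * (K * r)) `^ a * (1 + b^-1))).
    by rewrite gerBl divr_ge0 ?powR_ge0 ?ltW.
  rewrite /rho (negbTE an0) !powRM ?(ltW K0) ?(ltW r0) ?(ltW Kr0)//.
  rewrite -[leLHS]mulr1 (_ : 2 `^ a * _ * _ = 2 `^ a * (1 + b^-1) * K `^ a * r `^ a);
    last by ring.
  rewrite ler_wpM2l ?u1// !mulr_ge0 ?powR_ge0// addr_ge0// invr_ge0 ltW//.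
Qed.

Section ball_averages.
Context {R : realType} {d : nat}.
Local Notation V := 'rV[R]_d.
Local Notation leb := (@lebesgue_d R d).
Local Notation omega := (@unit_volume R d).
Variables (p a q : R) (f : V -> R).
Hypotheses (w0 : 0 < omega) (p1 : 1 <= p) (a0 : 0 <= a) (q0 : 0 <= q).
Hypothesis f_loc : L1loc f.
(** [q] stands for the seminorm of [f] with a power of the unit volume absorbed: on a ball of radius
    [s], the mean of order [p] of the oscillation is at most [q * s^a]. *)
Hypothesis f_osc : forall (x : V) (s : R), 0 < s ->
  (\int[leb]_(y in (eball x s : set (Rd R d))) (`|f y - avg f (eball x s)| `^ p)%:E
   <= (omega * s ^+ d * (q * s `^ a) `^ p)%:E)%E.

Lemma avg_eballE (g : V -> R) (x : V) (s : R) : 0 < s ->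
  avg g (eball x s) =
  (omega * s ^+ d)^-1 * Rintegral leb (eball x s : set (Rd R d)) g.
Proof. by move=> s0; rewrite /avg lebesgue_eball. Qed.

Let vol0 (s : R) : 0 < s -> 0 < omega * s ^+ d.
Proof. by move=> s0; rewrite mulr_gt0// exprn_gt0. Qed.

Lemma L1loc_measurable : measurable_fun [set: Rd R d] (f : Rd R d -> R).
Proof.
have -> : [set: Rd R d] = \bigcup_n (eball (0 : V) n.+1%:R : set (Rd R d)).
  apply/seteqP; split => // x _; exists (Num.truncn (enorm (x : V))) => //=.
  by rewrite /eball/= subr0 truncnS_gt.
apply/measurable_fun_bigcup => [n|n]; first exact: measurable_eball.
by apply/measurable_EFinP; exact: measurable_int (f_loc 0 _).
Qed.

(** Jensen on the small ball, followed by enlarging the domain to the big one, costs the volume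
    ratio, at most [4 ^+ d]. The ratio 4 accommodates both a doubling and the final, off-centre step
    of [avg_chain]. *)
Lemma avg_nested (x y : V) (s t : R) : 0 < s -> s <= t -> t <= 4 * s ->
  eball x s `<=` eball y t ->
  `|avg f (eball x s) - avg f (eball y t)| <= 4 ^+ d * q * t `^ a.
Proof.
move=> s0 st t4 sub; have t0 : 0 < t := lt_le_trans s0 st.
have p0 : 0 < p := lt_le_trans ltr01 p1.
set D := `|_|; have X0 : 0 <= q * t `^ a by rewrite mulr_ge0 ?powR_ge0.
have d4 : 1 <= 4 ^+ d :> R by rewrite exprn_ege1// ler1n.
(* Since [4 ^+ d >= 1] and [p >= 1], this factor is at most its own [p]-th power and need not be
   replaced by its root. *)
suff le_p : D `^ p <= 4 ^+ d * (q * t `^ a) `^ p.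
  rewrite leNgt; apply/negP => XD.
  have := @gt0_ltr_powR R p p0 _ _ _ _ XD.
  rewrite !nnegrE normr_ge0 -mulrA mulr_ge0// ?(le_trans ler01)// => /(_ isT isT).
  rewrite ltNge powRM ?(le_trans ler01 d4)// (le_trans le_p)//.
  by rewrite ler_wpM2r ?powR_ge0// le1r_powR.
have [igk gk] := average_sub (measurable_eball x s) (lebesgue_eball x s0)
  (vol0 s0) (avg f (eball y t)) (f_loc x s0).
have := powR_average_le (measurable_eball x s) (lebesgue_eball x s0) (vol0 s0) p1 igk.
rewrite gk -avg_eballE// -/D => le1.
have : ((omega * s ^+ d * D `^ p)%:E <= (omega * t ^+ d * (q * t `^ a) `^ p)%:E)%E.
  apply: (le_trans le1); apply: le_trans (f_osc y t0).
  apply: ge0_subset_integral => //; first exact: measurable_eball.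
  - exact: measurable_eball.
  - apply: measurable_powR_norm; apply: measurable_funB => //.
    by apply: measurable_funTS; exact: L1loc_measurable.
rewrite lee_fin -!mulrA ler_pM2l// => le2.
rewrite -(ler_pM2l (exprn_gt0 d s0)) (le_trans le2)// mulrA ler_wpM2r ?powR_ge0//.
by rewrite -exprMn (mulrC s) lerXn2r ?nnegrE ?mulr_ge0 ?(ltW t0) ?(ltW s0).
Qed.

Variables (T : R) (Psi : R -> R) (y : V).
Hypotheses (Psi_ge : forall s, 0 < s -> s <= T -> (2 * T) `^ a <= Psi s)
  (Psi_double : forall s, 0 < s -> 2 * s <= T -> (2 * s) `^ a + Psi (2 * s) <= Psi s).
Local Notation k := (avg f (eball y (2 * T))).

(** Induction on the number of doublings after which [s] exceeds [T]. While [2 * s <= T], pass to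
    the concentric ball of twice the radius, paid by [Psi_double]. Once [T < 2 * s], jump to the
    ball about [y] of radius [2 * T], which contains [eball x s] and is paid by [Psi_ge]. *)
Lemma avg_chain (x : V) (s : R) : 0 < s -> s <= T -> enorm (x - y) <= T ->
  `|avg f (eball x s) - k| <= 4 ^+ d * q * Psi s.
Proof.
move=> s0 sT xT.
have c0 : 0 <= 4 ^+ d * q by rewrite mulr_ge0// exprn_ge0.
have [n] : exists n, T < 2 ^+ n * s.
  exists (Num.truncn (T / s)).+1; rewrite -ltr_pdivrMr//.
  by rewrite (lt_le_trans (truncnS_gt _))// -natrX ler_nat ltnW// ltn_expl.
elim: n s s0 sT => [|n IHn] s s0 sT; first by rewrite expr0 mul1r ltNge sT.
rewrite exprSr -mulrA => Tn; have s20 : 0 < 2 * s by rewrite mulr_gt0.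
have [s2T|Ts2] := leP (2 * s) T.
  apply: le_trans (ler_distD (avg f (eball x (2 * s))) _ _) _.
  apply: (@le_trans _ _ (4 ^+ d * q * ((2 * s) `^ a + Psi (2 * s)))); last first.
    by rewrite ler_wpM2l// Psi_double.
  rewrite mulrDr lerD ?IHn//; apply: avg_nested => //; [lra|lra|].
  by apply: eball_sub; rewrite subrr enorm0; lra.
apply: (@le_trans _ _ (4 ^+ d * q * (2 * T) `^ a)); last first.
  by rewrite ler_wpM2l// Psi_ge.
by apply: avg_nested => //; [lra|lra|apply: eball_sub; lra].
Qed.

(** Both the oscillation of [f] on [eball x s] and the distance from its average to [k] are
    controlled by [Psi s]. *)
Lemma integral_eball_chain (x : V) (s : R) : 0 < s -> s <= T -> enorm (x - y) <= T ->
  (\int[leb]_(z in (eball x s : set (Rd R d))) (`|f z - k| `^ p)%:E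
   <= (omega * s ^+ d * (2 `^ p * 2 * (4 ^+ d * q * Psi s) `^ p))%:E)%E.
Proof.
move=> s0 sT xT; have p0 : 0 <= p := le_trans ler01 p1.
have mf : measurable_fun (eball x s : set (Rd R d)) (f : Rd R d -> R).
  by apply: measurable_funTS; exact: L1loc_measurable.
apply: le_trans (integral_powR_sub_le (measurable_eball x s) (lebesgue_eball x s0)
  p1 k (avg f (eball x s)) mf) _.
have -> : omega * s ^+ d * (2 `^ p * 2 * (4 ^+ d * q * Psi s) `^ p) =
  2 `^ p * (omega * s ^+ d * (4 ^+ d * q * Psi s) `^ p +
    omega * s ^+ d * (4 ^+ d * q * Psi s) `^ p) by ring.
rewrite (EFinM (2 `^ p)) lee_wpmul2l ?lee_fin ?powR_ge0// EFinD leeD//.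
  apply: (le_trans (f_osc x s0)); rewrite lee_fin ler_wpM2l ?(ltW (vol0 s0))//.
  have sP : s `^ a <= Psi s.
    apply: le_trans (Psi_ge s0 sT).
    by rewrite ge0_ler_powR ?nnegrE//; lra.
  have d4 : 1 <= 4 ^+ d :> R by rewrite exprn_ege1// ler1n.
  rewrite ge0_ler_powR ?nnegrE ?mulr_ge0 ?powR_ge0 ?exprn_ge0//.
    by rewrite (le_trans _ sP) ?powR_ge0.
  by rewrite ler_pM ?powR_ge0// ler_peMl.
rewrite lee_fin ler_wpM2l ?(ltW (vol0 s0))//.
rewrite ge0_ler_powR ?nnegrE//; last exact: avg_chain.
by rewrite (le_trans _ (avg_chain s0 sT xT)).
Qed.

End ball_averages.

(** * Composition with a measure-preserving bi-Lipschitz map *)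

Section composition.
Context {R : realType} {d : nat}.
Local Notation V := 'rV[R]_d.
Local Notation leb := (@lebesgue_d R d).
Local Notation omega := (@unit_volume R d).
Variables (phi : V -> V) (K : R).
Hypotheses (bphi : bijective phi) (pphi : preserves_lebesgue phi) (K2 : 2 <= K).
Hypotheses (phiK : forall x y, enorm (phi x - phi y) <= K * enorm (x - y))
  (phiK' : forall x y, enorm (x - y) <= K * enorm (phi x - phi y)).
Hypothesis w0 : 0 < omega.

Let K0 : 0 < K. Proof. exact: lt_le_trans K2. Qed.

Lemma measurable_phi_coord (i : 'I_d) :
  measurable_fun [set: Rd R d] (fun x : Rd R d => phi x ord0 i).
Proof. exact: (measurable_lipschitz_coord (ltW K0) phiK). Qed.

Lemma measurable_bilipschitz : measurable_fun [set: Rd R d] (phi : Rd R d -> Rd R d).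
Proof. exact: (measurable_phi bphi pphi (ltW K0) phiK). Qed.

Variables (c : V) (r : R).
Local Notation B := (eball c r : set (Rd R d)).

Definition radius_at (w : V) : R := (r - enorm (w - c)) / (4 * K).
Local Notation s := radius_at.

Let s_gt0 (w : V) : eball c r w -> 0 < s w.
Proof. by move=> cw; rewrite divr_gt0 ?mulr_gt0// subr_gt0. Qed.

Let s_le0 (w : V) : ~ eball c r w -> s w <= 0.
Proof.
move=> /negP; rewrite -leNgt => cw.
by rewrite pmulr_lle0 ?invr_gt0 ?mulr_gt0// subr_le0.
Qed.

(** The depth is 1-Lipschitz and the inverse of [phi] is [K]-Lipschitz, so dividing the depth by
    [4 * K] makes the radius 1/4-Lipschitz in the image point. *)
Lemma radius_at_lip (z w : V) : s w <= s z + enorm (phi z - phi w) / 4.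
Proof.
rewrite /s ler_pdivrMr ?mulr_gt0//.
have -> : ((r - enorm (z - c)) / (4 * K) + enorm (phi z - phi w) / 4) * (4 * K) =
  r - enorm (z - c) + K * enorm (phi z - phi w) by field; rewrite gt_eqF.
have h1 := enorm_triangle z w c; have h2 := phiK' z w.
lra.
Qed.

Lemma measurable_radius_at : measurable_fun [set: Rd R d] (s : Rd R d -> R).
Proof.
apply: measurable_funM; last exact: measurable_cst.
apply: measurable_funB; [exact: measurable_cst|exact: measurable_enorm_sub].
Qed.

Variable F : V -> R.
Hypotheses (F0 : forall x, 0 <= F x)
  (mF : measurable_fun [set: Rd R d] (F : Rd R d -> R)).

(* The inverse is written as a power because the library has a measurability
   lemma for [powR] but not for [^-1]. *)
Let h (zw : Rd R d * Rd R d) : R :=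
  if enorm (phi zw.1 - phi zw.2) < s zw.2
  then F (phi zw.1) * (omega * s zw.2 ^+ d) `^ (- 1) else 0.

Let h_ge0 zw : 0 <= h zw.
Proof. by rewrite /h; case: ifP => // _; rewrite mulr_ge0// powR_ge0. Qed.

Let mh : measurable_fun [set: Rd R d * Rd R d] h.
Proof.
apply: measurable_fun_ifT => //.
- apply: measurable_fun_ltr; last first.
    by apply: (measurableT_comp measurable_radius_at); exact: measurable_snd.
  apply: measurable_enorm => i; under eq_fun do rewrite !mxE.
  apply: measurable_funB; apply: (measurableT_comp (measurable_phi_coord i)).
    exact: measurable_fst.
  exact: measurable_snd.
- apply: measurable_funM.
    apply: (measurableT_comp mF).
    by apply: (measurableT_comp measurable_bilipschitz); exact: measurable_fst.
  apply: (measurableT_comp (measurable_powR _)); apply: measurable_funM => //.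
  apply: measurable_funX; apply: (measurableT_comp measurable_radius_at).
  exact: measurable_snd.
Qed.

Let mhE : measurable_fun [set: Rd R d * Rd R d] (fun zw => (h zw)%:E).
Proof. exact/measurable_EFinP. Qed.

Let measurable_ball_pre (x : V) (t : R) :
  measurable (phi @^-1` eball x t : set (Rd R d)).
Proof.
rewrite -[X in measurable X]setTI.
by apply: measurable_bilipschitz => //; exact: measurable_eball.
Qed.

(** Integrate only over the [w] whose image is within [s z / 2] of [phi z]. There [s w] lies between
    [s z / 2] and [2 * s z], so the kernel is at least [F (phi z)] over the volume of a ball of
    radius [2 * s z]. These [w] fill the volume of a ball of radius [s z / 2], and the ratio of the
    two volumes is [4^-d]. *)
Lemma average_kernel_ge (z : V) : eball c r z ->
  ((F (phi z))%:E <= (4 ^+ d)%:E * \int[leb]_w (h (z, w))%:E)%E.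
Proof.
move=> cz; have sz := s_gt0 cz.
have sz2 : 0 < s z / 2 by rewrite divr_gt0.
set E : set (Rd R d) := phi @^-1` eball (phi z) (s z / 2).
have mE : measurable E by exact: measurable_ball_pre.
have lE : leb E = (omega * (s z / 2) ^+ d)%:E.
  rewrite [LHS](outer_preimage_phi bphi pphi (ltW K0) phiK).
  exact: (lebesgue_eball _ sz2).
have s2z : 0 < (omega * (2 * s z) ^+ d) by rewrite mulr_gt0// exprn_gt0// mulr_gt0.
have lower (w : Rd R d) : E w ->
    ((F (phi z) / (omega * (2 * s z) ^+ d))%:E <= (h (z, w))%:E)%E.
  rewrite /E/=/eball/= enorm_distC => zw.
  have lip1 := radius_at_lip z w; have lip2 := radius_at_lip w z.
  rewrite enorm_distC in lip2.
  have sw : s z / 2 < s w by lra.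
  have sw2 : s w <= 2 * s z by lra.
  have sw0 : 0 < s w by lra.
  have vw0 : 0 < omega * s w ^+ d by rewrite mulr_gt0// exprn_gt0.
  rewrite lee_fin /h/= (lt_trans zw sw) ler_wpM2l// powR_inv1 ?(ltW vw0)//.
  by rewrite lef_pV2 ?posrE// ler_pM2l// lerXn2r ?nnegrE// ltW// mulr_gt0.
apply: (@le_trans _ _ ((4 ^+ d)%:E *
    \int[leb]_(w in E) (F (phi z) / (omega * (2 * s z) ^+ d))%:E)%E).
  rewrite integral_cst// [X in (_ * (_ * X))%E]lE -!EFinM lee_fin.
  have cancel_scales (x t : R) : 0 < t ->
      4 ^+ d * (x / (omega * (2 * t) ^+ d) * (omega * (t / 2) ^+ d)) = x.
    move=> t0; rewrite !exprMn exprVn (_ : 4 = 2 * 2) ?exprMn; last by ring.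
    by field; rewrite !expf_neq0// ?gt_eqF.
  by rewrite cancel_scales.
have mhz : measurable_fun [set: Rd R d] (fun w : Rd R d => (h (z, w))%:E).
  exact: (measurable_fun_pair2 (z : Rd R d) mhE).
rewrite lee_wpmul2l ?lee_fin ?exprn_ge0//.
apply: (@le_trans _ _ (\int[leb]_(w in E) (h (z, w))%:E)%E).
  apply: ge0_le_integral => //.
  - by move=> w _; rewrite lee_fin divr_ge0// ltW.
  - exact: measurable_funTS.
apply: ge0_subset_integral => //.
by move=> w _; rewrite lee_fin.
Qed.

(** Change of variables turns the integral in [z] into an average over the Whitney ball of [w];
    outside [eball c r] the radius is nonpositive and the kernel vanishes. *)
Lemma kernel_average_le (w : V) :
  (\int[leb]_z (h (z, w))%:E =
   if (enorm (w - c) < r)%R then ((omega * s w ^+ d)^-1)%:E *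
     \int[leb]_(x in (eball (phi w) (s w) : set (Rd R d))) (F x)%:E else 0)%E.
Proof.
case: ifPn => cw; last first.
  rewrite integral0_eq// => z _; rewrite /h/= ltNge.
  by rewrite (le_trans (s_le0 _) (enorm_ge0 _))//; apply/negP.
have sw := s_gt0 cw.
have vw0 : 0 < omega * s w ^+ d by rewrite mulr_gt0// exprn_gt0.
have mFE : measurable_fun [set: Rd R d] (fun x : Rd R d => (F x)%:E).
  exact/measurable_EFinP.
rewrite -(integral_comp_phi bphi pphi (ltW K0) phiK (measurable_eball _ _)) => //; last 2 first.
- exact: measurable_funTS.
- by move=> x _; rewrite lee_fin.
rewrite -ge0_integralZl//; last 3 first.
- apply: measurable_funTS; apply: (measurableT_comp mFE).
  exact: measurable_bilipschitz.
- by move=> x _; rewrite lee_fin.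
- by rewrite lee_fin invr_ge0 ltW.
rewrite [RHS]integral_mkcond; apply: eq_integral => z _.
rewrite patchE /h/= powR_inv1 ?(ltW vw0)//; case: ifPn => zw.
  by rewrite mem_set//= mulrC.
by rewrite memNset//=; exact/negP.
Qed.

(** Tonelli combines the two preceding lemmas. Only a measurable majorant [G] of the inner averages
    is required, which is what the doubling chain supplies. *)
Lemma integral_comp_le (G : Rd R d -> \bar R) : measurable_fun B G ->
  (forall w, B w -> ((omega * s w ^+ d)^-1)%:E *
     \int[leb]_(x in (eball (phi w) (s w) : set (Rd R d))) (F x)%:E <= G w)%E ->
  (\int[leb]_(z in B) (F (phi z))%:E <= (4 ^+ d)%:E * \int[leb]_(w in B) G w)%E.
Proof.
move=> mG FG.
have mint : measurable_fun [set: Rd R d] (fun z => \int[leb]_w (h (z, w))%:E)%E.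
  exact: (measurable_fun_fubini_tonelli_F (fun zw => (h zw)%:E) mhE h_ge0).
apply: (@le_trans _ _ (\int[leb]_(z in B) ((4 ^+ d)%:E * \int[leb]_w (h (z, w))%:E))%E).
  apply: ge0_le_integral.
  - exact: measurable_eball.
  - by move=> z _; rewrite lee_fin.
  - apply/measurable_EFinP; apply: measurable_funTS; apply: (measurableT_comp mF).
    exact: measurable_bilipschitz.
  - by apply: measurable_funeM; exact: measurable_funTS.
  - by move=> z; exact: average_kernel_ge.
have int0 (z : Rd R d) : (0 <= \int[leb]_w (h (z, w))%:E)%E.
  by apply: integral_ge0 => w _; rewrite lee_fin.
rewrite ge0_integralZl; [|exact: measurable_eball|exact: measurable_funTS|
  by move=> z _; exact: int0|by rewrite lee_fin exprn_ge0].
apply: lee_wpmul2l; first by rewrite lee_fin exprn_ge0.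
apply: (@le_trans _ _ (\int[leb]_z \int[leb]_w (h (z, w))%:E)%E).
  apply: ge0_subset_integral; [exact: measurable_eball|exact: measurableT|
    exact: mint|by move=> z _; exact: int0|exact: subsetT].
rewrite (fubini_tonelli (m1 := leb) (m2 := leb) (fun zw => (h zw)%:E) mhE h_ge0).
rewrite [leRHS]integral_mkcond; apply: ge0_le_integral.
- exact: measurableT.
- by move=> w _; apply: integral_ge0 => z _; rewrite lee_fin.
- exact: (measurable_fun_fubini_tonelli_G (fun zw => (h zw)%:E) mhE h_ge0).
- by apply/(measurable_restrictT _ (measurable_eball c r)).
- move=> w _; rewrite kernel_average_le patchE.
  by case: ifPn => cw; [rewrite mem_set//; exact: FG|rewrite memNset//; exact/negP].
Qed.

End composition.

(** * Bounds from [Kphi] and the estimate on a single ball *)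

Lemma Kphi_bounds (R : realType) (d : nat) (phi : 'rV[R]_d -> 'rV[R]_d) :
  (0 < d)%N -> bi_lipschitz phi ->
  [/\ 2 <= fine (Kphi phi),
      forall x y, enorm (phi x - phi y) <= fine (Kphi phi) * enorm (x - y) &
      forall x y, enorm (x - y) <= fine (Kphi phi) * enorm (phi x - phi y)].
Proof.
move=> d0 [L HL].
have dist0 x y : x != y -> 0 < enorm (x - y) /\ 0 < enorm (phi x - phi y).
  move=> xy; have xy0 : 0 < enorm (x - y).
    rewrite lt_neqAle enorm_ge0 andbT eq_sym; apply/eqP => /enorm_eq0/eqP.
    by rewrite subr_eq0; exact/negP.
  split=> //; rewrite lt_neqAle enorm_ge0 andbT; apply/eqP => e.
  by have [_] := HL x y; rewrite -e mulr0 leNgt xy0.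
pose ratio x y := enorm (phi x - phi y) / enorm (x - y)
  + enorm (x - y) / enorm (phi x - phi y).
have ub : (Kphi phi <= (L + L)%:E)%E.
  apply: ge_ereal_sup => _ [x [y [xy ->]]].
  have [? ?] := dist0 _ _ xy; have [? ?] := HL x y.
  by rewrite lee_fin lerD// ler_pdivrMr.
have lb x y : x != y -> ((ratio x y)%:E <= Kphi phi)%E.
  by move=> xy; apply: ereal_sup_ubound; exists x, y.
(* As [0 < d] there are two distinct points, so the supremum is not over the empty set; any one
   ratio, of the form [t + t^-1], is at least 2. *)
have n0 : (const_mx 1 : 'rV[R]_d) != 0.
  by apply/eqP => /rowP/(_ (Ordinal d0))/eqP; rewrite !mxE oner_eq0.
have two : 2 <= ratio (const_mx 1) 0.
  have [] := dist0 _ _ n0.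
  rewrite /ratio; set u := enorm (_ - 0); set v := enorm (phi _ - _) => u0 v0.
  have -> : v / u + u / v = (v ^+ 2 + u ^+ 2) / (u * v).
    by field; rewrite !gt_eqF.
  rewrite ler_pdivlMr ?mulr_gt0//; have := sqr_ge0 (u - v); rewrite sqrrB; lra.
have Kfin : Kphi phi \is a fin_num.
  rewrite fin_numElt (le_lt_trans ub (ltry _)) andbT.
  exact: lt_le_trans (ltNyr _) (lb _ _ n0).
have lbK x y : x != y -> ratio x y <= fine (Kphi phi).
  by move=> xy; rewrite -lee_fin fineK// lb.
split; first exact: le_trans two (lbK _ _ n0).
- move=> x y; have [->|xy] := eqVneq x y; first by rewrite !subrr enorm0 mulr0.
  have [x0 y0] := dist0 _ _ xy; rewrite -ler_pdivrMr//.
  by apply: le_trans (lbK _ _ xy); rewrite lerDl divr_ge0 ?enorm_ge0.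
- move=> x y; have [->|xy] := eqVneq x y; first by rewrite !subrr enorm0 mulr0.
  have [x0 y0] := dist0 _ _ xy; rewrite -ler_pdivrMr//.
  by apply: le_trans (lbK _ _ xy); rewrite lerDr divr_ge0 ?enorm_ge0.
Qed.

Lemma rho_gt0 (R : realType) (a K : R) : 2 <= K -> 0 < rho a K.
Proof.
move=> K2; rewrite /rho; case: eqP => _; last by rewrite powR_gt0; lra.
by rewrite ln_gt0; lra.
Qed.

(** [phi] maps [eball c r] into [eball (phi c) (K * r)], where [f] is integrable. *)
Lemma integrable_comp (R : realType) (d : nat) (phi : 'rV[R]_d -> 'rV[R]_d)
    (K : R) (f : 'rV[R]_d -> R) (c : 'rV[R]_d) (r : R) :
  bijective phi -> preserves_lebesgue phi -> 0 < K ->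
  (forall x y, enorm (phi x - phi y) <= K * enorm (x - y)) ->
  L1loc f -> 0 < r ->
  (@lebesgue_d R d).-integrable (eball c r : set (Rd R d))
    (EFin \o (fun x => f (phi x))).
Proof.
move=> bphi pphi K0 phiK f_loc r0.
have mphi := measurable_phi bphi pphi (ltW K0) phiK.
have mf := L1loc_measurable f_loc.
have Kr0 : 0 < K * r by rewrite mulr_gt0.
apply/integrableP; split.
  by apply/measurable_EFinP; apply: measurable_funTS; exact: (measurableT_comp mf).
have /integrableP[_] := f_loc (phi c) _ Kr0; apply: le_lt_trans.
have mnf : measurable_fun [set: Rd R d] (fun x : Rd R d => `|(f x)%:E|%E).
  apply: (measurableT_comp (@abse_measurable R setT)); exact/measurable_EFinP.
rewrite -(@integral_comp_phi _ _ _ _ bphi pphi (ltW K0) phiK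
  (eball (phi c) (K * r)) (fun x => `|(f x)%:E|%E) (measurable_eball _ _)); last 2 first.
- exact: measurable_funTS.
- by move=> x _; exact: abse_ge0.
apply: ge0_subset_integral.
- exact: measurable_eball.
- rewrite -[X in measurable X]setTI; apply: mphi => //; exact: measurable_eball.
- by apply: measurable_funTS; apply: (measurableT_comp mnf).
- by move=> x _; exact: abse_ge0.
- move=> x; rewrite /eball/= => xc; apply: (le_lt_trans (phiK _ _)).
  by rewrite ltr_pM2l.
Qed.

Lemma osc_comp_le (R : realType) (d : nat) (p a : R) :
  (0 < d)%N -> 1 <= p -> 0 <= a ->
  exists2 C : R, 0 < C &
    forall (phi : 'rV[R]_d -> 'rV[R]_d) (K : R),
    bijective phi -> preserves_lebesgue phi -> 2 <= K ->
    (forall x y, enorm (phi x - phi y) <= K * enorm (x - y)) ->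
    (forall x y, enorm (x - y) <= K * enorm (phi x - phi y)) ->
    0 < @unit_volume R d ->
    forall (f : 'rV[R]_d -> R) (q : R), L1loc f -> 0 <= q ->
    (forall (x : 'rV[R]_d) (s : R), 0 < s ->
      (\int[@lebesgue_d R d]_(y in (eball x s : set (Rd R d)))
         (`|f y - avg f (eball x s)| `^ p)%:E
       <= (@unit_volume R d * s ^+ d * (q * s `^ a) `^ p)%:E)%E) ->
    forall (c : 'rV[R]_d) (r : R), 0 < r ->
    (\int[@lebesgue_d R d]_(y in (eball c r : set (Rd R d)))
       (`|f (phi y) - avg (fun x => f (phi x)) (eball c r)| `^ p)%:E
     <= (C * (@unit_volume R d * r ^+ d * (q * rho a K * r `^ a) `^ p))%:E)%E.
Proof.
move=> d0 p1 a0; have p0 : 0 < p := lt_le_trans ltr01 p1.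
have [C1 C10 majorant] := @doubling_majorant R p a p1 a0.
pose A : R := 2 `^ p * 2.
have A0 : 0 < A by rewrite mulr_gt0// powR_gt0.
(* From left to right: replacing the average by [k], the Whitney kernel, the chain of averages (two
   factors), and the integral of the depth. *)
exists (A * (4 ^+ d * (A * (4 ^+ d * C1) `^ p * (4 * d%:R)))).
  by rewrite !mulr_gt0 ?powR_gt0 ?exprn_gt0 ?mulr_gt0 ?exprn_gt0 ?ltr0n.
move=> phi K bphi pphi K2 phiK phiK' w0 f q f_loc q0 f_osc c r r0.
have K0 : 0 < K := lt_le_trans (ltr0n R 2) K2.
have rho0 := rho_gt0 a K2.
have [Psi [Psi_ge Psi_double Psi_le]] := majorant K r K2 r0.
have Kr0 : 0 < K * r by rewrite mulr_gt0.
pose k := avg f (eball (phi c) (2 * (K * r))).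
have mf := L1loc_measurable f_loc.
have mphi := measurable_phi bphi pphi (ltW K0) phiK.
have vr0 : 0 < @unit_volume R d * r ^+ d by rewrite mulr_gt0// exprn_gt0.
have iphi := @integrable_comp R d phi K f c r bphi pphi K0 phiK f_loc r0.
rewrite avg_eballE//.
apply: (le_trans (integral_powR_sub_average_le (measurable_eball c r)
  (lebesgue_eball c r0) vr0 p1 k iphi)).
rewrite -/A -[X in (_ <= X%:E)%E]mulrA (EFinM A); apply: lee_wpmul2l.
  by rewrite lee_fin ltW.
pose F x := `|f x - k| `^ p.
have F0 x : 0 <= F x by exact: powR_ge0.
have mF : measurable_fun [set: Rd R d] (F : Rd R d -> R).
  apply: (measurableT_comp (measurable_powR p)).
  apply: (measurableT_comp (@normr_measurable R setT)).
  by apply: measurable_funB; [exact: mf|exact: measurable_cst].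
pose Q := A * (4 ^+ d * C1 * (q * rho a K * r `^ a)) `^ p.
have Q0 : 0 <= Q by rewrite mulr_ge0 ?powR_ge0 ?ltW.
pose G (w : Rd R d) : \bar R :=
  (Q%:E * ((1 - enorm ((w : 'rV[R]_d) - c) / r) `^ (- 2^-1))%:E)%E.
have mpow : measurable_fun (eball c r : set (Rd R d)) (fun w : Rd R d =>
    ((1 - enorm ((w : 'rV[R]_d) - c) / r) `^ (- 2^-1))%:E).
  apply/measurable_EFinP; apply: measurable_funTS.
  apply: (measurableT_comp (measurable_powR _)).
  apply: measurable_funB; first exact: measurable_cst.
  apply: measurable_funM; [exact: measurable_enorm_sub|exact: measurable_cst].
have mG : measurable_fun (eball c r : set (Rd R d)) G by exact: measurable_funeM.
apply: le_trans (integral_comp_le bphi pphi K2 phiK phiK' w0 F0 mF mG _) _.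
  move=> w cw; have cw' : enorm (w - c) < r by exact: cw.
  pose u := 1 - enorm (w - c) / r.
  have u0 : 0 < u by rewrite subr_gt0 ltr_pdivrMr// mul1r.
  have u1 : u <= 1 by rewrite gerBl divr_ge0 ?enorm_ge0 ?(ltW r0).
  have sE : radius_at K c r w = u * r / (4 * K).
    by rewrite /radius_at; congr (_ / _); rewrite /u mulrBl mul1r divfK ?gt_eqF.
  have s0 : 0 < u * r / (4 * K) by rewrite divr_gt0 ?mulr_gt0.
  have sKr : u * r / (4 * K) <= K * r.
    rewrite ler_pdivrMr ?mulr_gt0// mulrAC ler_pM2r//.
    by apply: (le_trans u1); nra.
  have wc : enorm (phi w - phi c) <= K * r.
    by rewrite (le_trans (phiK _ _))// ler_pM2l// ltW.
  have v0 : 0 < @unit_volume R d * (u * r / (4 * K)) ^+ d.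
    by rewrite mulr_gt0// exprn_gt0.
  rewrite sE lee_pdivrMl//.
  apply: (le_trans (integral_eball_chain w0 p1 a0 q0 f_loc f_osc Psi_ge Psi_double
    s0 sKr wc)).
  rewrite /G -!EFinM lee_fin ler_pM2l// -/A /Q -[leRHS]mulrA ler_pM2l//.
  (* The exponent in [doubling_majorant] was chosen so that its [p]-th power is this integrable
     power of the depth. *)
  have -> : (1 - enorm (w - c) / r) `^ (- 2^-1) = (u `^ (- (2 * p)^-1)) `^ p.
    by rewrite -powRrM; congr (_ `^ _); field; rewrite gt_eqF.
  have Psi0 : 0 <= Psi (u * r / (4 * K)).
    by rewrite (le_trans _ (Psi_ge _ s0 sKr))// powR_ge0.
  rewrite -powRM ?powR_ge0//; last first.
    by rewrite !mulr_ge0 ?exprn_ge0 ?powR_ge0// ltW.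
  have c0 : 0 <= 4 ^+ d * q by rewrite mulr_ge0 ?exprn_ge0.
  have le1 : 4 ^+ d * q * Psi (u * r / (4 * K)) <=
      4 ^+ d * C1 * (q * rho a K * r `^ a) * u `^ (- (2 * p)^-1).
    rewrite [leRHS](_ : _ = 4 ^+ d * q * (C1 * rho a K * r `^ a * u `^ (- (2 * p)^-1))).
      by rewrite ler_wpM2l// Psi_le.
    by ring.
  have ge0 := mulr_ge0 c0 Psi0.
  by apply: ge0_ler_powR; rewrite ?nnegrE ?(ltW p0)// (le_trans ge0 le1).
rewrite -[X in (_ <= X%:E)%E]mulrA (EFinM (4 ^+ d)); apply: lee_wpmul2l.
  by rewrite lee_fin exprn_ge0.
rewrite /G ge0_integralZl//; last 2 first.
- exact: measurable_eball.
- by move=> w _; rewrite lee_fin powR_ge0.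
apply: (@le_trans _ _ (Q%:E * (4 * d%:R * (@unit_volume R d * r ^+ d))%:E)%E).
  by apply: lee_wpmul2l; [rewrite lee_fin|exact: integral_depth_le].
rewrite -EFinM lee_fin /Q powRM; first 1 last.
- by rewrite mulr_ge0 ?exprn_ge0// ltW.
- by rewrite !mulr_ge0 ?powR_ge0 ?(ltW rho0).
by rewrite le_eqVlt; apply/orP; left; apply/eqP; ring.
Qed.

(** * From single balls to the seminorm *)

Unset Implicit Arguments.
Set Strict Implicit.

Theorem theorem2p1 (R : realType) (d : nat) (p a : R) :
  (0 < d)%N -> 1 <= p -> 0 <= a < 1 ->
  exists C : R, 0 < C /\
    forall phi : 'rV[R]_d -> 'rV[R]_d,
      bijective phi -> bi_lipschitz phi -> preserves_lebesgue phi ->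
      forall f : 'rV[R]_d -> R, L1loc f ->
        (sharp_norm p a (fun x => f (phi x))
           <= (C * rho a (fine (Kphi phi)))%:E * sharp_norm p a f)%E.
Proof.
move=> d0 p1 /andP[a0 _]; have p0 : 0 < p := lt_le_trans ltr01 p1.
have [C C0 main] := @osc_comp_le R d p a d0 p1 a0.
(* The estimate on balls concerns [p]-th powers, hence the root. *)
exists (C `^ p^-1); split; first exact: powR_gt0.
move=> phi bphi lphi pphi f f_loc.
have [K2 phiK phiK'] := Kphi_bounds d0 lphi.
set K := fine (Kphi phi) in K2 phiK phiK' *.
have rho0 := rho_gt0 a K2.
pose e := a * p / d%:R; have e0 : 0 <= e by rewrite divr_ge0// mulr_ge0// ltW.
pose supo (g : 'rV[R]_d -> R) := ereal_sup [set osc p a g B | B in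
  [set B : set 'rV[R]_d | exists (c : 'rV[R]_d) (r : R), (0 < r)%R /\ B = eball c r]].
have oscE (g : 'rV[R]_d -> R) (c : 'rV[R]_d) (r : R) : 0 < r ->
    osc p a g (eball c r) = ((((@unit_volume R d * r ^+ d) `^ (1 + e))^-1)%:E *
      \int[@lebesgue_d R d]_(y in (eball c r : set (Rd R d)))
        (`|g y - avg g (eball c r)| `^ p)%:E)%E.
  by move=> r0; rewrite /osc lebesgue_eball.
have osc_ge0 (g : 'rV[R]_d -> R) B : (0 <= osc p a g B)%E.
  rewrite /osc mule_ge0//; first by rewrite lee_fin invr_ge0 powR_ge0.
  by apply: integral_ge0 => y _; rewrite lee_fin powR_ge0.
have sharpE g : sharp_norm p a g = (supo g `^ p^-1)%E by [].
have sup_ge0 g : (0 <= supo g)%E.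
  apply: le_trans (osc_ge0 g (eball 0 1)) _; apply: ereal_sup_ubound.
  by exists (eball 0 1) => //; exists 0, 1.
suff le_sup : (supo (fun x => f (phi x)) <= (C * rho a K `^ p)%:E * supo f)%E.
  rewrite !sharpE.
  have -> : C `^ p^-1 * rho a K = (C * rho a K `^ p) `^ p^-1.
    rewrite (powRM _ (ltW C0) (powR_ge0 _ _)) -powRrM divff ?gt_eqF//.
    by rewrite powRr1// ltW.
  rewrite -poweR_EFin -poweRM ?lee_fin ?mulr_ge0 ?powR_ge0 ?(ltW C0)//.
  apply: gt0_ler_poweR; rewrite ?invr_ge0 ?(ltW p0)//.
  - by rewrite in_itv/= sup_ge0 leey.
  - by rewrite in_itv/= leey andbT mule_ge0// lee_fin mulr_ge0 ?powR_ge0// ltW.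
have Crho0 : 0 < C * rho a K `^ p by rewrite mulr_gt0// powR_gt0.
apply: ge_ereal_sup => _ [_ [c [r [r0 ->]]] <-].
(* The degenerate case [unit_volume = 0] is trivial with [0^-1 = 0]; treating it
   spares a proof that the outer measure of a ball is positive. *)
have [w00|w0] := eqVneq (@unit_volume R d) 0.
  rewrite oscE// w00 mul0r powR0 ?invr0 ?mul0e ?mule_ge0 ?lee_fin ?(ltW Crho0)//.
  by rewrite gt_eqF// ltr_pwDl.
have {}w0 : 0 < @unit_volume R d by rewrite lt_neqAle eq_sym w0 unit_volume_ge0.
have [->|supf] := eqVneq (supo f) +oo%E.
  by rewrite gt0_muley ?lte_fin// leey.
have fin : supo f \is a fin_num by rewrite ge0_fin_numE// ltey.
pose M := fine (supo f); have M0 : 0 <= M by exact: fine_ge0.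
have vol0 (s : R) : 0 < s -> 0 < @unit_volume R d * s ^+ d.
  by move=> s0; rewrite mulr_gt0// exprn_gt0.
(* Chosen so that [M] times the volume to the power [1 + e] is the volume times [(q * s^a)^p],
   because [d * e = a * p]. *)
pose q := (M * @unit_volume R d `^ e) `^ p^-1.
have qp : q `^ p = M * @unit_volume R d `^ e.
  by rewrite /q -powRrM mulVf ?gt_eqF// powRr1// mulr_ge0// powR_ge0.
have powE (s : R) : 0 < s -> M * (@unit_volume R d * s ^+ d) `^ (1 + e) =
    @unit_volume R d * s ^+ d * (q * s `^ a) `^ p.
  move=> s0; have s0' := ltW s0.
  rewrite (@powRM _ q) ?powR_ge0// qp -powRrM.
  rewrite powRD ?(gt_eqF (vol0 s s0)) ?implybT// powRr1 ?(ltW (vol0 s s0))//.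
  rewrite (@powRM _ _ (s ^+ d) e) ?exprn_ge0 ?(ltW w0)//.
  rewrite -(powR_mulrn _ s0') -(powRrM s) (_ : d%:R * e = a * p); first by ring.
  by rewrite /e mulrC divfK// pnatr_eq0 -lt0n.
have f_osc (x : 'rV[R]_d) (s : R) : 0 < s ->
    (\int[@lebesgue_d R d]_(y in (eball x s : set (Rd R d)))
       (`|f y - avg f (eball x s)| `^ p)%:E
     <= (@unit_volume R d * s ^+ d * (q * s `^ a) `^ p)%:E)%E.
  move=> s0; rewrite -powE// mulrC EFinM -lee_pdivrMl ?powR_gt0 ?vol0//.
  rewrite -oscE// /M fineK//; apply: ereal_sup_ubound.
  by exists (eball x s) => //; exists x, s.
have := main phi K bphi pphi K2 phiK phiK' w0 f q f_loc (powR_ge0 _ _) f_osc c r r0.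
rewrite oscE// lee_pdivrMl ?powR_gt0 ?vol0// => /le_trans; apply.
rewrite -(fineK fin) -/M -!EFinM lee_fin.
rewrite (_ : q * rho a K * r `^ a = rho a K * (q * r `^ a)); last by ring.
rewrite (powRM p (ltW rho0)) ?mulr_ge0 ?powR_ge0// [X in C * X]mulrCA -powE//.
by rewrite le_eqVlt; apply/orP; left; apply/eqP; ring.
Qed.
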